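(* Let $q\in L_1^{\mathrm{loc}}(\mathbb R)$ with $q\ge 0$. Suppose that the equation $-y''(x)+q(x)y(x)=f(x)$, $x\in\mathbb R$, is correctly solvable in $L_1(\mathbb R)$. Then the spaces $S_1^{(2)}(\mathbb R,q)$ and $W_1^{(2)}(\mathbb R,q)$ are isomorphic, i.e. they are normed spaces that coincide as sets and have equivalent norms.
   Context: $\|\cdot\|_1$ is the norm of $L_1(\mathbb R)$. $AC_{\mathrm{loc}}^{(1)}(\mathbb R)$ is the set of functions that are absolutely continuous together with their (first) derivatives on every finite interval of $\mathbb R$. Spaces: $S_1^{(2)}(\mathbb R,q)=\{y\in AC_{\mathrm{loc}}^{(1)}(\mathbb R):\ \|y''-qy\|_1+\|qy\|_1<\infty\}$ with norm $\|y''-qy\|_1+\|qy\|_1$, and $W_1^{(2)}(\mathbb R,q)=\{y\in AC_{\mathrm{loc}}^{(1)}(\mathbb R):\ \|y''\|_1+\|qy\|_1<\infty\}$ with norm $\|y''\|_1+\|qy\|_1$. Isomorphic: normed vector spaces $B_1$, $B_2$ are called isomorphic here if they coincide set-theoretically and have equivalent norms. Solution: a solution of $-y''+qy=f$ is any $y\in AC_{\mathrm{loc}}^{(1)}(\mathbb R)$ satisfying the equation almost everywhere on $\mathbb R$. Correct solvability: the equation $-y''+qy=f$ is correctly solvable in $L_1(\mathbb R)$ if (I) for every $f\in L_1(\mathbb R)$ there is a unique solution $y\in L_1(\mathbb R)$; and (II) there is a constant $c\in(0,\infty)$, independent of $f$, such that for every $f\in L_1(\mathbb R)$ the solution $y\in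 L_1(\mathbb R)$ satisfies $\|y\|_1\le c\|f\|_1$. *)

(* Defs.v *)
From HB Require Import structures.
From mathcomp Require Import all_boot all_order all_algebra.
From mathcomp Require Import all_classical all_reals all_analysis.

Set Implicit Arguments.
Unset Strict Implicit.
Unset Printing Implicit Defensive.

Import Order.TTheory GRing.Theory Num.Theory.
Import numFieldNormedType.Exports.

Local Open Scope classical_set_scope.
Local Open Scope ring_scope.

(* Degenerate subintervals [a i = b i] are allowed: they contribute 0 to both
   sums. *)
Definition abs_continuous_on (R : realType) (c d : R) (f : R -> R) : Prop :=
  forall e : R, 0 < e -> exists2 delta : R, 0 < delta &
    forall (n : nat) (a b : 'I_n -> R),
      (forall i, [/\ c <= a i, a i <= b i & b i <= d]) ->
      trivIset [set: 'I_n] (fun i => `]a i, b i[%classic) ->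
      \sum_(i < n) (b i - a i) < delta ->
      \sum_(i < n) `|f (b i) - f (a i)| < e.

Definition ACloc (R : realType) (f : R -> R) : Prop :=
  forall c d : R, c <= d -> abs_continuous_on c d f.

(* Absolute continuity of the derivative presupposes that it exists at every
   point; [derive1 y] has a junk value where [y] is not derivable. *)
Definition ACloc1 (R : realType) (y : R -> R) : Prop :=
  [/\ forall x : R, derivable y x 1, ACloc y & ACloc (derive1 y)].

(* The second derivative of a function in [ACloc1] exists almost everywhere.
   At the remaining points [D2 y] takes the constant default value of [lim], so
   that [D2 y] is Borel measurable ([derive1 y] being continuous), and neither
   the norms nor the almost everywhere equalities below depend on it. *)
Definition D2 (R : realType) (y : R -> R) : R -> R := derive1 (derive1 y).

Definition L1norm (R : realType) (f : R -> R) : \bar R :=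
  ('N[@lebesgue_measure R]_1[EFin \o f])%E.

(* Measurability is with respect to the Borel sets; every class of Lebesgue
   measurable functions modulo null sets has a Borel representative. *)
Definition in_L1 (R : realType) (f : R -> R) : Prop :=
  (@lebesgue_measure R).-integrable [set: R] (EFin \o f).

Definition is_solution (R : realType) (q f y : R -> R) : Prop :=
  ACloc1 y /\
  {ae @lebesgue_measure R, forall x, - D2 y x + q x * y x = f x}.

Definition correctly_solvable (R : realType) (q : R -> R) : Prop :=
  (forall f : R -> R, in_L1 f ->
     exists! y : R -> R, is_solution q f y /\ in_L1 y) /\
  (exists2 c : R, 0 < c &
     forall f y : R -> R, in_L1 f -> is_solution q f y -> in_L1 y ->
       (L1norm y <= c%:E * L1norm f)%E).

Definition S12_enorm (R : realType) (q y : R -> R) : \bar R :=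
  (L1norm (fun x => (D2 y x - q x * y x)%R)
   + L1norm (fun x => (q x * y x)%R))%E.

Definition W12_enorm (R : realType) (q y : R -> R) : \bar R :=
  (L1norm (D2 y) + L1norm (fun x => (q x * y x)%R))%E.

Definition S12 (R : realType) (q : R -> R) : set (R -> R) :=
  [set y | ACloc1 y /\ (S12_enorm q y < +oo)%E].

Definition W12 (R : realType) (q : R -> R) : set (R -> R) :=
  [set y | ACloc1 y /\ (W12_enorm q y < +oo)%E].

Definition S12_norm (R : realType) (q y : R -> R) : R := fine (S12_enorm q y).

Definition W12_norm (R : realType) (q y : R -> R) : R := fine (W12_enorm q y).

(* [B] is a linear space of functions (without identification of functions
   that agree almost everywhere), and [N] is a norm on it. *)
Definition normed_space (R : realType) (B : set (R -> R)) (N : (R -> R) -> R)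
    : Prop :=
  [/\ B (fun=> 0) /\
      (forall (a : R) u v, B u -> B v -> B (fun x => a * u x + v x)),
      forall u, B u -> 0 <= N u,
      forall u, B u -> N u = 0 -> u = (fun=> 0),
      forall (a : R) u, B u -> N (fun x => a * u x) = `|a| * N u &
      forall u v, B u -> B v -> N (fun x => u x + v x) <= N u + N v].

Definition equivalent_norms (R : realType) (B : set (R -> R))
    (N1 N2 : (R -> R) -> R) : Prop :=
  exists c C : R, [/\ 0 < c, 0 < C &
    forall u, B u -> c * N1 u <= N2 u /\ N2 u <= C * N1 u].

Definition isomorphic (R : realType) (B1 : set (R -> R)) (N1 : (R -> R) -> R)
    (B2 : set (R -> R)) (N2 : (R -> R) -> R) : Prop :=
  [/\ normed_space B1 N1, normed_space B2 N2, B1 = B2 &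
      equivalent_norms B1 N1 N2].

(* Main.v *)
(* A function y in AC_loc^(1) has y'' and qy measurable, so the triangle
   inequality bounds each of the two norms by twice the other one. What remains
   is that they are norms.

   Since D2 takes junk values where y' is not derivable, the linearity of D2
   (almost everywhere) needs Lebesgue's theorem for an absolutely continuous f.
   The total variation of f is again absolutely continuous, so f is a difference
   of nondecreasing absolutely continuous functions. The Stieltjes measure of
   each of them is dominated by the Lebesgue measure, and the Radon-Nikodym
   theorem followed by Lebesgue differentiation makes f the integral of its
   almost everywhere existing derivative.

   If the norm of y vanishes then y'' = 0 and qy = 0 almost everywhere, so y is
   affine, and y = 0 unless q = 0 almost everywhere. In that last case
   -y'' = f has no solution in L_1 when f is the indicator of [0, 1]. *)
Require Import Defs.
From HB Require Import structures.
From mathcomp Require Import all_boot all_order all_algebra.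
From mathcomp Require Import all_classical all_reals all_analysis.
From mathcomp Require Import measurable_realfun ring lra.

Set Implicit Arguments.
Unset Strict Implicit.
Unset Printing Implicit Defensive.

Import Order.TTheory GRing.Theory Num.Theory.
Import numFieldNormedType.Exports.

Local Open Scope classical_set_scope.
Local Open Scope ring_scope.

(** * Total variation of absolutely continuous functions *)

Section absolute_continuity.
Context {R : realType}.
Implicit Types (a b c d e delta : R) (f g : R -> R) (p : R * R) (s : seq (R * R)).

(** Sequences can be refined by concatenation, unlike families over ['I_n]. Common end points are
    allowed, but a degenerate interval strictly inside another one is not. *)
Definition nonoverlapping c d s :=
  all (fun p => [&& c <= p.1, p.1 <= p.2 & p.2 <= d]) s &&
  pairwise (fun p p' => (p.2 <= p'.1) || (p'.2 <= p.1)) s.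

Definition total_length s := \sum_(p <- s) (p.2 - p.1).

Definition total_increment f s := \sum_(p <- s) `|f p.2 - f p.1|.

Lemma abs_continuous_on_nonoverlapping c d f : abs_continuous_on c d f ->
  forall e, 0 < e -> exists2 delta, 0 < delta &
    forall s, nonoverlapping c d s -> total_length s < delta ->
      total_increment f s < e.
Proof.
move=> acf e /acf[delta delta0 H]; exists delta => // s /andP[/all_nthP sP].
move=> /(pairwiseP (0, 0)) disj.
rewrite /total_length /total_increment !(big_nth (0, 0)) !big_mkord => sd.
apply: (H _ (fun i : 'I_(size s) => (nth (0, 0) s i).1)
            (fun i : 'I_(size s) => (nth (0, 0) s i).2)) => //.
  by move=> i; have /and3P[] := sP (0, 0) i (ltn_ord i).
have disj' (i j : 'I_(size s)) : (i < j)%N ->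
    `](nth (0, 0) s i).1, (nth (0, 0) s i).2[ `&`
    `](nth (0, 0) s j).1, (nth (0, 0) s j).2[ = set0 :> set R.
  move=> ij; rewrite -subset0 => x /= []; rewrite !in_itv /=.
  move=> /andP[i1 i2] /andP[j1 j2].
  have /orP[h|h] := disj i j (ltn_ord i) (ltn_ord j) ij.
    by have := lt_trans j1 (lt_le_trans i2 h); rewrite ltxx.
  by have := lt_trans i1 (lt_le_trans j2 h); rewrite ltxx.
apply/trivIsetP => i j _ _; rewrite -(inj_eq val_inj) /= neq_ltn => /orP[|] ij.
  exact: disj'.
by rewrite setIC; exact: disj'.
Qed.

Definition partition_pairs a (t : seq R) := zip (a :: t) t.

Lemma nonoverlapping_partition_pairs a b t : itv_partition a b t ->
  nonoverlapping a b (partition_pairs a t).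
Proof.
elim: t a => [|x t ih] a; first by [].
move=> [/= /andP[ax xt] tb]; have xbt : itv_partition x b t by split.
have xb := itv_partition_le xbt.
rewrite /nonoverlapping /= lexx (ltW ax) xb /=.
have /andP[/allP h1 h2] := ih x xbt.
apply/andP; split; first last.
  rewrite h2 andbT; apply/allP => p /h1 /and3P[xp _ _] /=.
  by rewrite xp.
apply/allP => p /h1 /and3P[xp -> ->]; rewrite !andbT.
by rewrite (le_trans (ltW ax) xp).
Qed.

Lemma total_length_partition_pairs a b t : itv_partition a b t ->
  total_length (partition_pairs a t) = b - a.
Proof.
rewrite /total_length.
elim: t a => [|x t ih] a abt.
  by rewrite (itv_partition_nil abt) subrr big_nil.
rewrite /partition_pairs /= big_cons /= ih; last exact: itv_partition_cons abt.
by rewrite addrC addrA subrK.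
Qed.

Lemma total_increment_partition_pairs f a b t : itv_partition a b t ->
  total_increment f (partition_pairs a t) = variation a b f t.
Proof.
move=> abt; rewrite (variation_zip _ abt) /total_increment.
elim: t a abt => [|x t ih] a abt; first by rewrite !big_nil.
rewrite /partition_pairs /= !big_cons /= ih//.
exact: itv_partition_cons abt.
Qed.

(** A subinterval of [p] stays apart from whatever [p] avoids. The refinement lands behind [s1], as
    the induction below requires. *)
Lemma nonoverlapping_refine c d p s s1 s2 :
  nonoverlapping c d ((p :: s1) ++ s2) -> nonoverlapping p.1 p.2 s ->
  nonoverlapping c d (s1 ++ (s ++ s2)).
Proof.
rewrite /nonoverlapping cat_cons /= => /andP[/andP[/and3P[cp pp pd] sA] /andP[ps sP]].
move=> /andP[/allP h1 h2].
have sin : all (fun p => [&& c <= p.1, p.1 <= p.2 & p.2 <= d]) s.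
  apply/allP => r /h1 /and3P[r1 -> r2].
  by rewrite (le_trans cp r1) (le_trans r2 pd).
have disj r r' : r \in s ->
    (p.2 <= r'.1) || (r'.2 <= p.1) -> (r.2 <= r'.1) || (r'.2 <= r.1).
  move=> /h1 /and3P[r1 _ r2] /orP[h|h].
    by rewrite (le_trans r2 h).
  by rewrite (le_trans h r1) orbT.
move: sA sP ps; rewrite !all_cat sin !pairwise_cat h2.
move=> /andP[-> ->] /and3P[all12 -> ->] /andP[ps1 ps2] /=; rewrite andbT.
rewrite allrel_catr all12 andbT; apply/andP; split.
  apply/allrelP => x y xs1 ys /=; rewrite orbC; apply: disj => //.
  by rewrite (allP ps1).
apply/allrelP => x y xs ys2; apply: disj => //.
by rewrite (allP ps2).
Qed.

(* The intervals of [s1] are replaced one by one with the consecutive pairs of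
   a partition, whose increments add up to a variation of [f]. *)
Lemma total_variation_increment_le c d f e delta :
  (forall s, nonoverlapping c d s -> total_length s < delta ->
    total_increment f s <= e) ->
  forall s1 s2, nonoverlapping c d (s1 ++ s2) -> total_length (s1 ++ s2) < delta ->
    (\sum_(p <- s1) total_variation p.1 p.2 f + (total_increment f s2)%:E
       <= e%:E)%E.
Proof.
move=> H; elim=> [|p s1 ih] s2 nov len.
  by rewrite big_nil add0e lee_fin; exact: H.
have pP : [&& c <= p.1, p.1 <= p.2 & p.2 <= d].
  by move: nov => /andP[/andP[]].
have H1 t : itv_partition p.1 p.2 t ->
    (\sum_(p <- s1) total_variation p.1 p.2 f +
      (variation p.1 p.2 f t + total_increment f s2)%:E <= e%:E)%E.
  move=> pt; rewrite -(total_increment_partition_pairs _ pt).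
  rewrite [X in X%:E](_ : _ = total_increment f (partition_pairs p.1 t ++ s2)).
    apply: ih; first exact: nonoverlapping_refine nov
      (nonoverlapping_partition_pairs pt).
    move: len; rewrite /total_length !big_cat /= big_cons /=.
    have := total_length_partition_pairs pt; rewrite /total_length => ->.
    by rewrite addrCA addrA.
  by rewrite /total_increment big_cat.
have tv0 : (0 <= \sum_(p <- s1) total_variation p.1 p.2 f)%E.
  rewrite big_seq; apply: sume_ge0 => r rs1; apply: total_variation_ge0.
  move: nov => /andP[/allP /(_ r)]; rewrite cat_cons inE mem_cat rs1 orbT.
  by move=> /(_ isT)/and3P[].
(* Finiteness permits moving the sum to the other side before the supremum over [t] is taken. It
   follows from [H1] for a single partition, the empty one if [p] is degenerate. *)
have fin : (\sum_(p <- s1) total_variation p.1 p.2 f)%E \is a fin_num.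
  rewrite ge0_fin_numE//; have [t pt] : exists t, itv_partition p.1 p.2 t.
    move: pP => /and3P[_ + _]; rewrite le_eqVlt => /predU1P[->|].
      by exists [::]; split.
    by exists [:: p.2]; exact: itv_partition1.
  rewrite (le_lt_trans _ (le_lt_trans (H1 _ pt) (ltry _)))//.
  rewrite leeDl// lee_fin addr_ge0//; first exact: variation_ge0.
  by rewrite /total_increment sumr_ge0.
rewrite big_cons /= -addeA -leeBrDr; last by rewrite fin_numD fin.
apply: ge_ereal_sup => _ [_ [t pt <-] <-].
rewrite leeBrDr; last by rewrite fin_numD fin.
by rewrite addeCA -EFinD; exact: H1.
Qed.
End absolute_continuity.

(** * Bounded variation and the Jordan decomposition *)

Section absolute_continuity_total_variation.
Context {R : realType}.
Implicit Types (a b c d e delta : R) (f g : R -> R) (p : R * R) (s : seq (R * R)).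

Lemma nonoverlapping_abs_continuous_on c d f :
  (forall e, 0 < e -> exists2 delta, 0 < delta &
    forall s, nonoverlapping c d s -> total_length s < delta ->
      total_increment f s < e) ->
  abs_continuous_on c d f.
Proof.
move=> H e /H[delta delta0 {}H]; exists delta => // n a b ab disj len.
(* Degenerate intervals are dropped: having empty interior, they may lie inside other intervals of
   the family, which [nonoverlapping] forbids. *)
pose J := [seq i <- enum 'I_n | a i < b i].
pose s := [seq (a i, b i) | i <- J].
have sumJ (F : 'I_n -> R) : (forall i, a i = b i -> F i = 0) ->
    \sum_(i < n) F i = \sum_(i <- J) F i.
  move=> F0; rewrite /J big_filter big_enum_cond/=.
  rewrite (bigID (fun i => a i < b i))/= [X in _ + X]big1 ?addr0//.
  move=> i; rewrite -leNgt => ba; apply: F0; apply/eqP.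
  by rewrite eq_le ba; have [_ -> _] := ab i.
have ss : nonoverlapping c d s.
  apply/andP; split.
    by apply/allP => _ /mapP[i _ ->] /=; have [-> -> ->] := ab i.
  rewrite /s pairwise_map.
  have : pairwise (fun i j => i != j) J.
    by rewrite -uniq_pairwise filter_uniq// enum_uniq.
  apply: (sub_in_pairwise (P := [in J])); last exact/allP.
  have Jab i : i \in J -> a i < b i by rewrite mem_filter => /andP[].
  move=> i j iJ jJ ij /=; have iab := Jab i iJ; have jab := Jab j jJ.
  apply/negPn/negP; rewrite negb_or -!ltNge => /andP[ji ij'].
  move/trivIsetP : disj => /(_ i j I I ij).
  (* Two overlapping open intervals would share the midpoint of []l, r[]. *)
  pose l := Num.max (a i) (a j); pose r := Num.min (b i) (b j).
  have lr : l < r by rewrite /l /r gt_max !lt_min iab ij' jab ji.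
  apply/eqP/set0P; exists ((l + r) / 2).
  have [lm mr] : l < (l + r) / 2 /\ (l + r) / 2 < r by rewrite !midf_lt.
  move: lm mr; rewrite [l < _]gt_max [_ < r]lt_min.
  move=> /andP[? ?] /andP[? ?].
  by split => /=; rewrite in_itv/=; apply/andP.
have := H s ss; rewrite /total_length /total_increment /s !big_map /=.
rewrite -!sumJ; first exact.
- by move=> i ->; rewrite subrr normr0.
- by move=> i ->; rewrite subrr.
Qed.

Lemma abs_continuous_on_combination c d f g a :
  abs_continuous_on c d f -> abs_continuous_on c d g ->
  abs_continuous_on c d (fun x => a * f x + g x).
Proof.
move=> acf acg e e0.
(* The summand 1 keeps the divisor positive when [a = 0]. *)
have a0 : 0 < `|a| + 1 by rewrite ltr_wpDl.
have e1 : 0 < e / 2 / (`|a| + 1) by rewrite !divr_gt0.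
have [d1 d10 H1] := acf _ e1.
have [d2 d20 H2] := acg (e / 2) (divr_gt0 e0 (ltr0n _ 2)).
exists (Num.min d1 d2); first by rewrite lt_min d10.
move=> n u v uv disj; rewrite lt_min.
move=> /andP[/(H1 n u v uv disj) l1 /(H2 n u v uv disj) l2].
apply: (@le_lt_trans _ _
    (\sum_(i < n) (`|a| * `|f (v i) - f (u i)| + `|g (v i) - g (u i)|))).
  apply: ler_sum => i _; rewrite -normrM opprD addrACA -mulrBr.
  exact: ler_normD.
rewrite big_split/= -mulr_sumr [e]splitr ltr_leD//; last exact: ltW.
apply: (@le_lt_trans _ _ ((`|a| + 1) * \sum_(i < n) `|f (v i) - f (u i)|)).
  by rewrite ler_wpM2r// ?sumr_ge0// lerDl.
by rewrite mulrC -ltr_pdivlMr.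
Qed.

(** On an interval shorter than [delta] the variation is at most 1, and finitely many such intervals
    cover [[c, d]]. *)
Lemma abs_continuous_on_bounded_variation c d f : c <= d ->
  abs_continuous_on c d f -> bounded_variation c d f.
Proof.
move=> cd /abs_continuous_on_nonoverlapping /(_ 1 ltr01)[delta delta0 H].
apply/bounded_variationP => //; rewrite ge0_fin_numE ?total_variation_ge0//.
have small x y : c <= x -> x <= y -> y <= d -> y - x < delta ->
    (total_variation x y f < +oo)%E.
  move=> cx xy yd xyd.
  have := @total_variation_increment_le R c d f 1 delta
    (fun s ss len => ltW (H s ss len)) [:: (x, y)] [::].
  rewrite /nonoverlapping /= cx xy yd /total_length /total_increment.
  rewrite !big_seq1 big_nil adde0 => /(_ isT xyd) /le_lt_trans; apply.
  exact: ltry.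
have d2 : 0 < delta / 2 by rewrite divr_gt0.
have [n] : exists n : nat, (d - c) / (delta / 2) < n%:R.
  by exists (Num.truncn ((d - c) / (delta / 2))).+1; exact: truncnS_gt.
rewrite ltr_pdivrMr//.
(* Induction on the number of pieces, each of length [delta / 2], that are cut off at the right
   end. *)
elim: n d cd H small => [|n ih] y cy H small ycn.
  by move: ycn; rewrite mul0r subr_lt0 ltNge cy.
have [yc|yc] := leP (y - delta / 2) c.
  apply: small => //; rewrite (le_lt_trans (y := delta / 2))//; first by lra.
  by lra.
rewrite (@total_variationD _ c y (y - delta / 2)) ?ltW//; last by lra.
rewrite lte_add_pinfty//; last by apply: small => //; lra.
apply: ih.
- exact: ltW.
- move=> s /andP[sA sP]; apply: H; rewrite /nonoverlapping sP andbT.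
  apply: sub_all sA => p /and3P[-> -> /= /le_trans]; apply.
  by rewrite gerBl ltW.
- by move=> x z cx xz zy; apply: small => //; lra.
- by move: ycn; rewrite mulrSr mulrDl mul1r; lra.
Qed.

(** Additivity turns increments of the variation function into variations over subintervals, whose
    sum is bounded by [total_variation_increment_le]. *)
Lemma abs_continuous_on_total_variation c d f : c <= d ->
  abs_continuous_on c d f ->
  abs_continuous_on c d (fun x => fine (total_variation c x f)).
Proof.
move=> cd acf; have bvf := abs_continuous_on_bounded_variation cd acf.
apply: nonoverlapping_abs_continuous_on => e e0.
(* The bound on the sum of variations is not strict, hence [e / 2]. *)
have e20 : 0 < e / 2 by rewrite divr_gt0.
have [delta delta0 H] := abs_continuous_on_nonoverlapping acf e20.
exists delta => // s ss len.
have := @total_variation_increment_le R c d f (e / 2) delta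
  (fun s ss len => ltW (H s ss len)) s [::].
rewrite cats0 => /(_ ss len); rewrite /total_increment big_nil adde0 => h.
rewrite (@le_lt_trans _ _ (e / 2))//; last by rewrite ltr_pdivrMr// ltr_pMr// ltr1n.
rewrite -lee_fin (le_trans _ h)// -sumEFin !big_seq.
apply: lee_sum => p ps; have /and3P[cp pp pd] : [&& c <= p.1, p.1 <= p.2 & p.2 <= d].
  by move/andP : ss => [/allP/(_ _ ps)].
have cp2 := le_trans cp pp.
have fin1 : total_variation c p.1 f \is a fin_num.
  apply/bounded_variationP => //.
  by apply: bounded_variationl bvf => //; exact: le_trans pd.
have fin2 : total_variation p.1 p.2 f \is a fin_num.
  apply/bounded_variationP => //.
  apply: (bounded_variationl _ pd) => //.
  by apply: bounded_variationr bvf => //; exact: le_trans pd.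
rewrite (total_variationD f cp pp) fineD// addrC addKr ger0_norm.
  by rewrite fineK.
by rewrite fine_ge0// total_variation_ge0.
Qed.

(** Jordan decomposition [f = T - (T - f)], where [T] is the variation function. *)
Lemma abs_continuous_on_decomposition c d f : c <= d ->
  abs_continuous_on c d f -> exists g1 g2 : R -> R,
  [/\ {in `[c, d] &, nondecreasing_fun g1}, {in `[c, d] &, nondecreasing_fun g2},
      abs_continuous_on c d g1, abs_continuous_on c d g2 &
      forall x, f x = g1 x - g2 x].
Proof.
move=> cd acf; have bvf := abs_continuous_on_bounded_variation cd acf.
have acT := abs_continuous_on_total_variation cd acf.
pose T x := fine (total_variation c x f).
have step x y : c <= x -> x <= y -> y <= d -> `|f y - f x| <= T y - T x.
  move=> cx xy yd; have cy := le_trans cx xy.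
  have fin1 : total_variation c x f \is a fin_num.
    apply/bounded_variationP => //.
    by apply: bounded_variationl bvf => //; exact: le_trans yd.
  have fin2 : total_variation x y f \is a fin_num.
    apply/bounded_variationP => //.
    apply: (bounded_variationl _ yd) => //.
    by apply: bounded_variationr bvf => //; exact: le_trans yd.
  rewrite /T (total_variationD f cx xy) fineD// [leRHS]addrC addKr.
  by rewrite -lee_fin fineK// total_variation_ge.
exists T, (fun x => -1 * f x + T x); split => //.
- move=> x y; rewrite !in_itv/= => /andP[cx _] /andP[_ yd] xy.
  by rewrite -subr_ge0 (le_trans _ (step _ _ cx xy yd)).
- move=> x y; rewrite !in_itv/= => /andP[cx _] /andP[_ yd] xy.
  have := le_trans (ler_norm _) (step _ _ cx xy yd); lra.
- exact: abs_continuous_on_combination.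
- by move=> x; rewrite mulN1r opprD opprK addrCA subrr addr0.
Qed.

End absolute_continuity_total_variation.

(** * Absolutely continuous functions as integrals *)

Section stieltjes_dominated.
Context {R : realType}.
Implicit Types (a b c d e : R) (G g : R -> R).
Local Notation mu := (@lebesgue_measure R).

(** Absolute continuity on the whole line at once, because cumulative functions live on all of
    [R]. *)
Definition uniformly_abs_continuous G := forall e, 0 < e ->
  exists2 delta : R, 0 < delta & forall (n : nat) (a b : 'I_n -> R),
    (forall i, a i <= b i) ->
    trivIset [set: 'I_n] (fun i => `]a i, b i[%classic) ->
    \sum_(i < n) (b i - a i) < delta ->
    \sum_(i < n) `|G (b i) - G (a i)| < e.

Lemma uniformly_abs_continuous_small_increment G : uniformly_abs_continuous G ->
  forall e, 0 < e -> exists2 delta : R, 0 < delta &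
    forall a b, a <= b -> b - a < delta -> `|G b - G a| < e.
Proof.
move=> acG e /acG[delta delta0 H]; exists delta => // a b ab abd.
have := H 1%N (fun=> a) (fun=> b); rewrite !big_ord1; apply => //.
by apply/trivIsetP => i j _ _; rewrite !ord1 eqxx.
Qed.

Lemma uniformly_abs_continuous_continuous G :
  uniformly_abs_continuous G -> continuous G.
Proof.
move=> /uniformly_abs_continuous_small_increment H x.
apply/cvgrPdist_lt => e /H[delta delta0 {}H].
near=> y; have yx : `|x - y| < delta by near: y; exact: cvgr_dist_lt.
have [xy|/ltW xy] := leP x y.
  by rewrite distrC H// -(ger0_norm (x := y - x)) ?subr_ge0// distrC.
by rewrite H// -(ger0_norm (x := x - y)) ?subr_ge0.
Unshelve. all: by end_near. Qed.

Lemma lebesgue_stieltjes_measure_itv_oc (G : cumulative R R) a b : a <= b ->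
  lebesgue_stieltjes_measure G `]a, b]%classic = (G b - G a)%:E.
Proof.
move=> ab; rewrite /lebesgue_stieltjes_measure /measure_extension/=.
rewrite measurable_mu_extE/=; last exact: is_ocitv.
exact: wlength_itv_bnd.
Qed.

(** The point lies in []a - delta / 2, a]], whose measure is a small increment of [G]. *)
Lemma lebesgue_stieltjes_measure_set1 (G : cumulative R R) a :
  uniformly_abs_continuous G -> lebesgue_stieltjes_measure G [set a] = 0%E.
Proof.
move=> /uniformly_abs_continuous_small_increment H.
apply/eqP; rewrite eq_le measure_ge0 andbT.
apply/lee_addgt0Pr => e /H[delta delta0 {}H].
rewrite add0e.
have d2 : a - delta / 2 <= a by rewrite gerBl divr_ge0// ltW.
apply: (@le_trans _ _ (lebesgue_stieltjes_measure G `]a - delta / 2, a]%classic)).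
  apply: le_measure; rewrite ?inE.
  - exact: measurable_set1.
  - exact: measurable_itv.
  - by move=> x /= ->; rewrite in_itv/= lexx andbT gtrBl divr_gt0.
rewrite lebesgue_stieltjes_measure_itv_oc// lee_fin.
apply: le_trans (ler_norm _) _; apply/ltW/H => //.
by rewrite opprB addrCA subrr addr0 ltr_pdivrMr// ltr_pMr// ltr1n.
Qed.

(** A nonempty unbounded interval has infinite measure, so two real end points remain. The two
    inclusions cover every choice of which end points belong to [A]. *)
Lemma is_interval_finite_measure (A : set R) : is_interval A -> (mu A < +oo)%E ->
  exists a b, [/\ a <= b, `]a, b[ `<=` A, A `<=` `[a, b] & mu A = (b - a)%:E].
Proof.
move=> /is_intervalP -> ; move: (Rhull A) => i {A}.
have empty (j : interval R) : [set` j] = set0 ->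
    exists a b, [/\ a <= b, `]a, b[ `<=` [set` j], [set` j] `<=` `[a, b] &
                   mu [set` j] = (b - a)%:E].
  move=> j0; exists 0, 0; split => //.
  - by move=> x; rewrite /= in_itv/= => /andP[/lt_trans h /h]; rewrite ltxx.
  - by rewrite j0.
  - by rewrite j0 measure0 subrr.
have [/empty //|/neitvP ine] := eqVneq [set` i] set0.
rewrite lebesgue_measure_itv.
move: i ine => [[ba a|[]] [bb b|[]]]//= iab.
all: rewrite ?ltNyr ?ltry ?ltNyy //=.
have ab : a <= b by move: iab; case: ba; case: bb; rewrite bnd_simp // => /ltW.
rewrite lte_fin => _.
exists a, b; split => //.
- move=> x /=; rewrite !in_itv/= => /andP[ax xb].
  by case: ba {iab}; case: bb => /=; rewrite ?ax ?xb ?(ltW ax) ?(ltW xb).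
- move=> x /=; rewrite !in_itv/=.
  by case: ba {iab}; case: bb => /= /andP[]; do ?[move=> -> | move=> /ltW ->].
- move: ab; rewrite le_eqVlt => /predU1P[->|->]; last by rewrite EFinB.
  by rewrite ltxx subrr.
Qed.

(* An open set of small measure containing a null set is a disjoint union of
   intervals, on which the increments of [G] add up to at most [e]. *)
Lemma lebesgue_stieltjes_dominated (G : cumulative R R) :
  uniformly_abs_continuous G -> lebesgue_stieltjes_measure G `<< mu.
Proof.
move=> acG; apply/null_content_dominatesP => A mA A0.
apply/eqP; rewrite eq_le measure_ge0 andbT.
apply/lee_addgt0Pr => e /acG[delta delta0 H].
rewrite add0e.
have [U [oU AU]] := outer_measure_open_le A (divr_gt0 delta0 (ltr0n R 2)).
have -> : ((wlength idfun)^*%mu A)%E = 0%E.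
  by apply/negligible_outer_measure/negligibleP.
rewrite add0e => muU.
apply: (@le_trans _ _ (lebesgue_stieltjes_measure G U)).
  by apply: le_measure; rewrite ?inE//; exact: open_measurable oU.
pose I := open_disjoint_itv oU.
have mI k : measurable (I k) by apply: open_measurable; exact: open_disjoint_itv_open.
have tI : trivIset setT I by exact: open_disjoint_itv_trivIset.
have IU : U = \bigcup_k I k by exact: open_disjoint_itv_bigcup.
have sumI (m : {measure set (measurableTypeR R) -> \bar R}) :
    m U = (\sum_(k <oo) m (I k))%E.
  rewrite IU measure_bigcup//; last by move=> k _; exact: mI.
  by apply: eq_eseriesl => k; rewrite in_setT.
have muIn n : (\sum_(k < n) mu (I k) < delta%:E)%E.
  apply: (@le_lt_trans _ _ (mu U)).
    by rewrite sumI -(big_mkord xpredT (fun k => mu (I k))); exact: nneseries_lim_ge.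
  by rewrite (le_lt_trans muU)// lte_fin ltr_pdivrMr// ltr_pMr// ltr1n.
have fin k : exists ab : R * R, [/\ ab.1 <= ab.2, `]ab.1, ab.2[ `<=` I k,
    I k `<=` `[ab.1, ab.2] & mu (I k) = (ab.2 - ab.1)%:E].
  have [|a [b ?]] := @is_interval_finite_measure (I k)
      (@open_disjoint_itv_is_interval _ _ oU k).
    rewrite (le_lt_trans _ (lt_trans (muIn k.+1) (ltry _)))// big_ord_recr/=.
    by rewrite leeDr// sume_ge0.
  by exists (a, b).
have [ab /all_and4[ab12 abI Iab muI]] := choice fin.
(* Absolute continuity speaks of finite families, so the partial sums are bounded. *)
rewrite sumI; apply: lime_le; first exact: is_cvg_nneseries.
apply: nearW => n; rewrite big_mkord.
apply: (@le_trans _ _ (\sum_(k < n) `|G (ab k).2 - G (ab k).1|)%:E); last first.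
  rewrite lee_fin ltW//; apply: H => //.
    apply/trivIsetP => i j _ _ ij; move/trivIsetP : tI => /(_ i j Logic.I Logic.I).
    move=> /(_ ij) Iij; rewrite -subset0 -Iij; exact: setISS.
  rewrite -lte_fin -sumEFin; under eq_bigr do rewrite -muI.
  exact: muIn.
rewrite -sumEFin; apply: lee_sum => k _.
(* The closed interval around [I k] consists of its left end point, which is a null set, and a
   half-open interval whose measure is an increment of [G]. *)
apply: (@le_trans _ _ (lebesgue_stieltjes_measure G
    ([set (ab k).1] `|` `](ab k).1, (ab k).2]))).
  apply: le_measure; rewrite ?inE//.
  - exact: mI.
  - by apply: measurableU; [exact: measurable_set1 | exact: measurable_itv].
  - by rewrite setU1itv ?bnd_simp; [exact: Iab | exact: ab12].
have m1 : measurable ([set (ab k).1] : set (measurableTypeR R)).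
  exact: measurable_set1.
have m2 : measurable (`](ab k).1, (ab k).2] : set (measurableTypeR R)).
  exact: measurable_itv.
apply: (le_trans (measureU2 (lebesgue_stieltjes_measure G) m1 m2)).
rewrite [X in (X + _)%E]lebesgue_stieltjes_measure_set1// add0e.
by rewrite [leLHS]lebesgue_stieltjes_measure_itv_oc// lee_fin ler_norm.
Qed.

End stieltjes_dominated.

#[local] Instance lebesgue_ae_filter (R : realType) :
  Filter (nbhs (almost_everywhere (@lebesgue_measure R))).
Proof. exact: ae_filter_ringOfSetsType. Qed.

(** * Lebesgue's theorem for absolutely continuous functions *)

Section integral_of_derivative.
Context {R : realType}.
Implicit Types (a b c d e x : R) (f g h : R -> R).
Local Notation mu := (@lebesgue_measure R).

(** Composition with this projection onto [[c, d]] extends a function by constants to the whole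
    line. *)
Let clamp c d x : R := Num.max c (Num.min x d).

Let clamp_in c d x : c <= d -> c <= clamp c d x <= d.
Proof. by move=> cd; rewrite /clamp le_max lexx /= ge_max cd ge_min lexx orbT. Qed.

Let clamp_id c d x : c <= x -> x <= d -> clamp c d x = x.
Proof. by move=> cx xd; rewrite /clamp min_l// max_r. Qed.

Let clamp_le c d x y : x <= y -> clamp c d x <= clamp c d y.
Proof. by move=> xy; rewrite /clamp le_max2// le_min2. Qed.

(** Clamping is monotone and does not increase lengths. A point strictly between two clamped values
    is strictly between the original ones, so disjointness survives. *)
Lemma abs_continuous_on_clamp c d g : c <= d -> abs_continuous_on c d g ->
  uniformly_abs_continuous (g \o clamp c d).
Proof.
move=> cd acg e /acg[delta delta0 H]; exists delta => // n a b ab disj len.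
apply: (H n (clamp c d \o a) (clamp c d \o b)).
- move=> i /=; have /andP[-> _] := clamp_in (a i) cd.
  by have /andP[_ ->] := clamp_in (b i) cd; rewrite clamp_le.
- apply/trivIsetP => i j _ _ ij.
  move/trivIsetP : disj => /(_ i j Logic.I Logic.I ij) disj.
  rewrite -subset0 -disj; apply: setISS => x /=; rewrite !in_itv/= /clamp;
    rewrite gt_max lt_max gt_min !lt_min; case/andP=> /andP[cx];
    by case/orP => [-> | dx] /orP[|/andP[]]; lra.
- apply: le_lt_trans len; apply: ler_sum => i _; rewrite /= /clamp.
  have := ab i.
  by rewrite /Num.max /Num.min; do ![case: ifPn => //]; rewrite -?leNgt; lra.
Qed.

Lemma nondecreasing_abs_continuous_on_integral c d g : c <= d ->
  {in `[c, d] &, nondecreasing_fun g} -> abs_continuous_on c d g ->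
  exists2 h, mu.-integrable setT (EFin \o h) &
    forall x, c <= x <= d -> g x = g c + \int[mu]_(t in `]c, x]) h t.
Proof.
move=> cd ndg acg; pose G := g \o clamp c d.
have acG : uniformly_abs_continuous G by exact: abs_continuous_on_clamp.
have ndG : nondecreasing G.
  by move=> x y xy; apply: ndg; rewrite ?in_itv/= ?clamp_in// clamp_le.
have rcG : right_continuous G.
  by apply: right_continuousW; exact: uniformly_abs_continuous_continuous.
pose Gc := isCumulative.Build R _ R G ndG rcG.
pose GG : cumulative R R := HB.pack G Gc.
pose nu := lebesgue_stieltjes_measure GG.
have mcd : measurable (`]c, d] : set (measurableTypeR R)) by exact: measurable_itv.
have nucd : (nu `]c, d]%classic < +oo)%E.
  by rewrite /nu lebesgue_stieltjes_measure_itv_oc// ltry.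
(* Restricting to []c, d]] gives a finite measure, to which the Radon-Nikodym theorem is applied. *)
pose nu' : {finite_measure set (measurableTypeR R) -> \bar R} := mfrestr mcd nucd.
have dom : nu' `<< mu.
  apply/null_content_dominatesP => A mA A0.
  have /null_content_dominatesP dom := lebesgue_stieltjes_dominated (G := GG) acG.
  apply/eqP; rewrite eq_le measure_ge0 andbT -(dom A mA A0).
  by apply: le_measure; rewrite ?inE//; exact: measurableI.
have [h [h0 hfin hint hE]] := radon_nikodym_sigma_finite dom.
exists (fine \o h).
  by apply: eq_integrable hint => // x _ /=; rewrite fineK.
move=> x /andP[cx xd].
have mcx : measurable (`]c, x] : set (measurableTypeR R)) by exact: measurable_itv.
have := hE _ mcx.
rewrite [LHS](_ : _ = (g x - g c)%:E).
  move=> H; rewrite /Rintegral; under eq_integral do rewrite /= fineK//.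
  by rewrite -H /= addrC subrK.
rewrite [LHS](_ : _ = nu `]c, x]%classic).
  rewrite /nu lebesgue_stieltjes_measure_itv_oc//= /G /=.
  by rewrite !clamp_id.
congr nu; rewrite setIidl//.
by apply: subset_itvl; rewrite bnd_simp.
Qed.

Lemma abs_continuous_on_integral c d f : c <= d -> abs_continuous_on c d f ->
  exists2 h, mu.-integrable setT (EFin \o h) &
    forall x, c <= x <= d -> f x = f c + \int[mu]_(t in `]c, x]) h t.
Proof.
move=> cd /(abs_continuous_on_decomposition cd)[g1 [g2 [nd1 nd2 ac1 ac2 fE]]].
have [h1 ih1 h1E] := nondecreasing_abs_continuous_on_integral cd nd1 ac1.
have [h2 ih2 h2E] := nondecreasing_abs_continuous_on_integral cd nd2 ac2.
exists (h1 \- h2).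
  exact: (@integrableB _ _ _ mu setT measurableT (EFin \o h1) (EFin \o h2)).
move=> x cxd; rewrite !fE h1E// h2E// RintegralB//.
- by rewrite opprD addrACA.
- exact: integrableS ih1.
- exact: integrableS ih2.
Qed.

(** Near an interior point [f] coincides with a constant plus the indefinite integral of [h], to
    which [FTC1] applies. *)
Lemma abs_continuous_on_ae_derivable c d f h : c < d ->
  mu.-integrable setT (EFin \o h) ->
  (forall x, c <= x <= d -> f x = f c + \int[mu]_(t in `]c, x]) h t) ->
  {ae mu, forall x, c < x < d -> derivable f x 1 /\ derive1 f x = h x}.
Proof.
move=> cd ih fE.
have loch : locally_integrable setT h.
  by apply: open_integrable_locally => //; exact: openT.
have ihc y : mu.-integrable [set` Interval (BRight c) (BRight y)] (EFin \o h).
  by apply: integrableS ih => //; exact: measurable_itv.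
have := FTC1 ihc loch; apply: filterS => x H /andP[cx xd].
have [derF F'E] := H cx.
have nearE : \near x, f c + \int[mu]_(t in `]c, x]) h t = f x.
  have xcd : x \in `]c, d[ by rewrite in_itv/= cx.
  near=> y; apply/esym/fE.
  have : y \in `]c, d[ by near: y; exact: near_in_itvoo.
  by rewrite in_itv/= => /andP[/ltW -> /ltW ->].
split.
  apply: (near_eq_derivable nearE).
  by apply: derivableD => //; exact: derivable_cst.
rewrite derive1E -(near_eq_derive _ nearE) -F'E derive1E.
by rewrite deriveD// derive_cst add0r.
Unshelve. all: by end_near. Qed.

(** Countably many bounded intervals exhaust the line, and a countable union of null sets is
    null. *)
Lemma ACloc_ae_derivable f : ACloc f -> {ae mu, forall x, derivable f x 1}.
Proof.
move=> acf.
have : {ae mu, forall x, forall n : nat, - n.+1%:R < x < n.+1%:R -> derivable f x 1}.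
  apply: ae_foralln => n.
  have n0 : - n.+1%:R < n.+1%:R :> R by rewrite gtrN// ltr0n.
  have [h ih fE] := abs_continuous_on_integral (ltW n0) (acf _ _ (ltW n0)).
  by have := abs_continuous_on_ae_derivable n0 ih fE; apply: filterS => x H /H[].
apply: filterS => x; have := truncnS_gt `|x|.
by rewrite ltr_norml => xn; apply; exact: xn.
Qed.

Lemma ACloc_ae_derive_eq0 f : ACloc f -> {ae mu, forall x, derive1 f x = 0} ->
  forall x y, f x = f y.
Proof.
move=> acf f'0 x y; wlog xy : x y / x < y.
  by move=> H; have [/H//|/H//|->//] := ltgtP x y.
(* The derivative is identified only inside an open interval; the end point [y + 1] makes [y]
   interior. *)
have y1 : x < y + 1 by rewrite ltr_wpDr.
have [h ih fE] := abs_continuous_on_integral (ltW y1) (acf _ _ (ltW y1)).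
rewrite (fE y) ?(ltW xy) ?lerDl//= /Rintegral.
rewrite (ae_eq_integral (cst 0%E))//.
- by rewrite integral0 addr0.
- apply: measurable_funTS; exact: measurable_int ih.
- have := abs_continuous_on_ae_derivable y1 ih fE.
  apply: filterS2 f'0 => t f't H; rewrite /= in_itv/= => /andP[xt ty].
  have [|_ h0] := H; first by rewrite xt (le_lt_trans ty)// ltrDl.
  by rewrite -h0 f't.
Qed.

(** Near [x], [f] agrees with its clamped extension from [[x - 1, x + 1]]. *)
Lemma ACloc_continuous f : ACloc f -> continuous f.
Proof.
move=> acf x; have x1 : x - 1 <= x + 1 by lra.
have cfc : continuous (f \o clamp (x - 1) (x + 1)).
  apply: uniformly_abs_continuous_continuous.
  exact: abs_continuous_on_clamp x1 (acf _ _ x1).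
have := cfc x; rewrite /continuous_at /= clamp_id ?gerBl ?lerDl//.
apply: cvg_trans; apply: near_eq_cvg.
have xcd : x \in `]x - 1, x + 1[ by rewrite in_itv/= gtrBl ltrDl ltr01.
near=> y; have : y \in `]x - 1, x + 1[ by near: y; exact: near_in_itvoo.
by rewrite in_itv/= => /andP[/ltW ? /ltW ?]; rewrite clamp_id.
Unshelve. all: by end_near. Qed.

End integral_of_derivative.

(** * The second derivative and the two norms *)

Section measurable_derive1.
Context {R : realType}.
Variable g : R -> R.
Hypothesis cg : continuous g.

Let Q (p x : R) : R := p^-1 * (g (p + x) - g x).

Let cQ p : continuous (Q p).
Proof.
move=> x; apply: cvgM; [exact: cvg_cst | apply: cvgB; last exact: cg].
apply: (@continuous_comp _ _ _ (fun y => p + y) g); last exact: cg.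
by apply: cvgD; [exact: cvg_cst | exact: cvg_id].
Qed.

(* The Cauchy criterion for the difference quotient, uniformly in arbitrary
   increments, so that no rational approximation is needed: [C k m] is closed. *)
Let C (k m : nat) : set R := [set x | forall p q : R, p != 0 -> q != 0 ->
  `|p| < m.+1%:R^-1 -> `|q| < m.+1%:R^-1 -> `|Q p x - Q q x| <= k.+1%:R^-1].

Let closed_C k m : closed (C k m).
Proof.
have -> : C k m = \bigcap_(pq in [set pq : R * R | [/\ pq.1 != 0, pq.2 != 0,
    `|pq.1| < m.+1%:R^-1 & `|pq.2| < m.+1%:R^-1]])
    ((fun x => `|Q pq.1 x - Q pq.2 x|) @^-1` [set y | y <= k.+1%:R^-1]).
  apply/seteqP; split => x /= H.
    by move=> [p q] /= [p0 q0 pm qm]; exact: H.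
  by move=> p q p0 q0 pm qm; apply: (H (p, q)).
apply: closed_bigI => -[p q] _; apply: preimage_closed; last exact: closed_le.
by move=> x _; apply: cvg_norm; apply: cvgB; exact: cQ.
Qed.

Let quotient_cvgP x : cvg (Q p x @[p --> 0^']) <-> (\bigcap_k \bigcup_m C k m) x.
Proof.
split=> [/cvg_ex[/= l Ql] k _|H].
  have k0 : 0 < k.+1%:R^-1 / 2 :> R by rewrite divr_gt0.
  have /cvgrPdist_lt /(_ _ k0) := Ql.
  rewrite /dnbhs /within /= => /nbhs_ballP[d /= d0 dP].
  exists (Num.truncn d^-1) => //= p q p0 q0 pd qd.
  have md : (Num.truncn d^-1).+1%:R^-1 < d.
    by rewrite -[ltRHS]invrK ltf_pV2 ?posrE ?invr_gt0// truncnS_gt.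
  have small r : r != 0 -> `|r| < (Num.truncn d^-1).+1%:R^-1 ->
      `|l - Q r x| < k.+1%:R^-1 / 2.
    move=> r0 rd; apply: dP => //; rewrite -ball_normE /ball_ /=.
    by rewrite sub0r normrN (lt_trans rd).
  have -> : Q p x - Q q x = (l - Q q x) - (l - Q p x) by ring.
  rewrite (le_trans (ler_normB _ _))// [leRHS]splitr lerD// ltW//; exact: small.
apply: cauchy_cvg; apply: cauchy_exP => e e0.
have [m _ Cm] := H (Num.truncn e^-1) Logic.I.
(* With [m.+2] instead of [m.+1], [q] satisfies the strict bound in [C]. *)
pose q : R := m.+2%:R^-1.
have q0 : 0 < q by rewrite invr_gt0.
exists (Q q x); suff : \forall p \near (0 : R)^', ball (Q q x) e (Q p x) by [].
near=> p; rewrite -ball_normE /ball_ /=.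
apply: (@le_lt_trans _ _ (Num.truncn e^-1).+1%:R^-1).
  apply: Cm.
  - exact: lt0r_neq0.
  - by near: p; exact: nbhs_dnbhs_neq.
  - by rewrite gtr0_norm// ltf_pV2 ?posrE// ltr_nat.
  - near: p; apply: dnbhs0_lt; by rewrite invr_gt0.
by rewrite -[ltRHS]invrK ltf_pV2 ?posrE ?invr_gt0// truncnS_gt.
Unshelve. all: by end_near. Qed.

(** The set of convergence is Borel by the Cauchy criterion, and [derive1 g] is an everywhere
    pointwise limit of measurable functions. *)
Lemma measurable_derive1 : measurable_fun [set: R] (derive1 g).
Proof.
pose E : set R := [set x | cvg (Q p x @[p --> 0^'])].
have mE : measurable E.
  rewrite (_ : E = \bigcap_k \bigcup_m C k m); last first.
    by apply/seteqP; split => x /quotient_cvgP.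
  apply: bigcapT_measurable => k; apply: bigcupT_measurable => m.
  by apply: closed_measurable; exact: closed_C.
(* [point] is the value of a divergent [lim], hence of [derive1 g] outside [E]. *)
pose u n x : R := if x \in E then Q n.+1%:R^-1 x else point.
apply: (@measurable_fun_cvg _ _ _ _ u) => [n|x _].
  apply: measurable_fun_ifT => //; last exact: continuous_measurable_fun.
  by apply: (measurable_fun_bool true); rewrite setTI preimage_mem_true.
have [xE|xE] := pselect (E x).
  have -> : u ^~ x = (fun n => Q n.+1%:R^-1 x).
    by apply/funext => n; rewrite /u mem_set.
  have /cvgr_dnbhsP : Q p x @[p --> 0^'] --> derive1 g x by [].
  apply; split => [n|]; first by rewrite invr_eq0.
  exact: cvg_harmonic.
have -> : u ^~ x = (fun=> point) by apply/funext => n; rewrite /u memNset.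
have -> : derive1 g x = point by exact: dvgP.
exact: cvg_cst.
Qed.

End measurable_derive1.

(** * Basic properties of the norm of L_1 *)

Section L1norm.
Context {R : realType}.
Implicit Types (f g : R -> R) (a : R).
Local Notation mu := (@lebesgue_measure R).

Lemma L1normE f : L1norm f = (\int[mu]_x `|f x|%:E)%E.
Proof. by rewrite /L1norm Lnorm1. Qed.

Lemma L1norm_ge0 f : (0 <= L1norm f)%E.
Proof. exact: Lnorm_ge0. Qed.

Lemma L1norm_ae_eq f g : measurable_fun setT f -> measurable_fun setT g ->
  {ae mu, forall x, f x = g x} -> L1norm f = L1norm g.
Proof.
move=> mf mg fg; rewrite !L1normE; apply: ae_eq_integral => //.
- by apply/measurable_EFinP; exact: measurableT_comp.
- by apply/measurable_EFinP; exact: measurableT_comp.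
- by apply: filterS fg => x -> _.
Qed.

Lemma L1norm_combination f g a : measurable_fun setT f -> measurable_fun setT g ->
  (L1norm (fun x => (a * f x + g x)%R) <= `|a|%:E * L1norm f + L1norm g)%E.
Proof.
move=> mf mg.
have maf : measurable_fun setT (fun x => a * f x) by exact: measurable_funM.
apply: (le_trans (minkowski_EFin mu maf mg (lexx 1))).
rewrite leeD2r// -[leLHS]/(L1norm (fun x => a * f x)) !L1normE -ge0_integralZl//.
  by rewrite le_eqVlt; apply/orP; left; apply/eqP; apply: eq_integral => x _;
    rewrite normrM EFinM.
by apply/measurable_EFinP; exact: measurableT_comp.
Qed.

Lemma L1norm_eq0 f : measurable_fun setT f -> L1norm f = 0%E ->
  {ae mu, forall x, f x = 0}.
Proof.
move=> mf f0.
have mf' : measurable_fun [set: measurableTypeR R] (EFin \o f).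
  exact/measurable_EFinP.
have := Lnorm_eq0_eq0 mf' lte01 f0.
by apply: filterS => x /(_ Logic.I) [].
Qed.

Lemma not_in_L1 f (A : set R) : measurable A -> mu A = +oo%E ->
  (forall x, A x -> 1 <= `|f x|) -> ~ in_L1 f.
Proof.
move=> mA Aoo fA /integrableP[/measurable_EFinP mf]; apply/negP; rewrite -leNgt.
rewrite -Aoo -[leLHS]mul1e -integral_cst//.
apply: (@le_trans _ _ (\int[mu]_(x in A) `|(EFin \o f) x|)%E).
  apply: ge0_le_integral => //.
  apply: measurable_funTS; apply: measurableT_comp => //; exact/measurable_EFinP.
apply: ge0_subset_integral => //.
by apply: measurableT_comp => //; exact/measurable_EFinP.
Qed.
End L1norm.

(** * Linearity and kernel of the second derivative *)

Section ACloc1.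
Context {R : realType}.
Implicit Types (q u v : R -> R) (a : R).
Local Notation mu := (@lebesgue_measure R).

Lemma derive1_combination u v a x : derivable u x 1 -> derivable v x 1 ->
  derivable (fun x => a * u x + v x) x 1 /\
  derive1 (fun x => a * u x + v x) x = a * derive1 u x + derive1 v x.
Proof.
move=> du dv.
have dau : derivable (a *: u) x 1 by exact: derivableZ.
split; first by apply: (@derivableD _ _ _ (a *: u) v).
rewrite !derive1E (@deriveD _ _ _ (a *: u) v)//.
by rewrite (@deriveZ _ _ _ u a).
Qed.

Lemma ACloc1_combination u v a : ACloc1 u -> ACloc1 v ->
  ACloc1 (fun x => a * u x + v x).
Proof.
move=> [du acu acu'] [dv acv acv']; split.
- by move=> x; have [] := derive1_combination a (du x) (dv x).
- by move=> c d cd; apply: abs_continuous_on_combination; [exact: acu|exact: acv].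
- rewrite (_ : derive1 _ = (fun x => a * derive1 u x + derive1 v x)).
    by move=> c d cd; apply: abs_continuous_on_combination; [exact: acu'|exact: acv'].
  by apply/funext => x; have [] := derive1_combination a (du x) (dv x).
Qed.

Lemma ACloc1_cst0 : ACloc1 (fun=> 0 : R).
Proof.
have ac0 : ACloc (fun=> 0 : R).
  move=> c d _ e e0; exists 1 => // n a b _ _ _.
  by rewrite big1// => i _; rewrite subrr normr0.
split => //.
rewrite (_ : derive1 _ = fun=> 0)//; apply/funext => x.
exact: derive1_cst.
Qed.

Lemma ACloc1_continuous u : ACloc1 u -> continuous u.
Proof. by move=> [_ acu _]; exact: ACloc_continuous. Qed.

Lemma measurable_D2 u : ACloc1 u -> measurable_fun [set: R] (D2 u).
Proof. by move=> [_ _ acu']; apply: measurable_derive1; exact: ACloc_continuous. Qed.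

(** First derivatives combine everywhere, second ones wherever [derive1 u] and [derive1 v] are both
    derivable. *)
Lemma ae_D2_combination u v a : ACloc1 u -> ACloc1 v ->
  {ae mu, forall x, D2 (fun x => a * u x + v x) x = a * D2 u x + D2 v x}.
Proof.
move=> [du acu acu'] [dv acv acv'].
have -> : D2 (fun x => a * u x + v x) =
    derive1 (fun x => a * derive1 u x + derive1 v x).
  congr derive1; apply/funext => x.
  by have [] := derive1_combination a (du x) (dv x).
have := ACloc_ae_derivable acv'.
apply: filterS2 (ACloc_ae_derivable acu') => x du' dv'.
by have [] := derive1_combination a du' dv'.
Qed.

Lemma ACloc1_affine u : ACloc1 u -> {ae mu, forall x, D2 u x = 0} ->
  exists k, forall x, u x = u 0 + k * x.
Proof.
move=> [du acu acu'] D2u0; exists (derive1 u 0) => x.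
have cst := ACloc_ae_derive_eq0 acu' D2u0.
(* As [derive1 u] is constant, subtracting the line of slope [derive1 u 0] leaves a function with
   zero derivative everywhere. *)
have : forall t : R, is_derive t 1 (fun t => - derive1 u 0 * t + u t) 0.
  move=> t; have did : derivable (@id R) t 1 by exact: derivable_id.
  have [d dE] := derive1_combination (- derive1 u 0) did (du t).
  apply: DeriveDef => //; rewrite -derive1E dE.
  rewrite (cst t 0) [derive1 id t]derive1E derive_id; ring.
move=> H; have := @is_derive_0_is_cst R _ x 0 H; rewrite /=; lra.
Qed.

End ACloc1.

(** * Correct solvability excludes a vanishing potential *)

Section nonzero_potential.
Context {R : realType}.
Implicit Types (q u y : R -> R) (c s x : R).
Local Notation mu := (@lebesgue_measure R).

(** A primitive of the indicator of [[0, 1]], apart from the corners at 0 and 1. *)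
Let ramp x : R := Num.max 0 (Num.min x 1).

Let ACloc_ramp : ACloc ramp.
Proof.
move=> c d _ e e0; exists e => // n a b ab _; apply: le_lt_trans.
apply: ler_sum => i _; have [_ aibi _] := ab i.
by rewrite /ramp /Num.max /Num.min ler_norml;
  do ![case: ifPn => //]; rewrite -?leNgt; lra.
Qed.

Let ae_derive1_ramp :
  {ae mu, forall x, derivable ramp x 1 /\ derive1 ramp x = \1_`[0, 1] x}.
Proof.
have near_derive (f1 f2 : R -> R) x : (\forall y \near x, f1 y = f2 y) ->
    derivable f1 x 1 -> derivable f2 x 1 /\ derive1 f2 x = derive1 f1 x.
  by move=> f12 df1; split; [exact: near_eq_derivable f12 df1|
    rewrite !derive1E (near_eq_derive _ f12)].
have mu1 c : {ae mu, forall x, x != c}.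
  exists [set c]; split.
  - exact: measurable_set1.
  - exact: lebesgue_measure_set1.
  - by move=> x /= /negP; rewrite negbK => /eqP.
apply: filterS2 (mu1 0) (mu1 1) => x x0 x1.
have near_oo c d : c < x < d -> \forall y \near x, c < y < d.
  move=> cxd; have xcd : x \in `]c, d[ by rewrite in_itv.
  near=> y; have : y \in `]c, d[ by near: y; exact: near_in_itvoo.
  by rewrite in_itv.
have dcst (c : R) : derivable (fun=> c) x 1 by exact: derivable_cst.
have did : derivable (@id R) x 1 by exact: derivable_id.
have [x_lt0|x_gt0|] := ltgtP x 0; last by move/eqP; rewrite (negPf x0).
- have [|? ->] := near_derive (fun=> 0) ramp x _ (dcst _).
    have := near_oo (x - 1) 0; rewrite gtrBl ltr01 x_lt0 => /(_ isT).
    apply: filterS => y /andP[_ y0].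
    by rewrite /ramp min_l ?max_l//; lra.
  by split => //; rewrite derive1_cst indicE memNset//= in_itv/= leNgt x_lt0.
have [x_lt1|x_gt1|] := ltgtP x 1; last by move/eqP; rewrite (negPf x1).
- have [|? ->] := near_derive id ramp x _ did.
    have := near_oo 0 1; rewrite x_gt0 x_lt1 => /(_ isT).
    apply: filterS => y /andP[y0 y1].
    by rewrite /ramp min_l ?max_r//; lra.
  split => //; rewrite derive1E derive_id indicE mem_set//= in_itv/=.
  by rewrite !ltW.
- have [|? ->] := near_derive (fun=> 1) ramp x _ (dcst _).
    have := near_oo 1 (x + 1); rewrite ltrDl ltr01 x_gt1 => /(_ isT).
    apply: filterS => y /andP[y1 _].
    by rewrite /ramp min_r ?max_r//; lra.
  split => //; rewrite derive1_cst indicE memNset//= in_itv/=.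
  by rewrite [x <= 1]leNgt x_gt1 andbF.
Unshelve. all: by end_near. Qed.

Let derive_cst_increment y c d s : (forall x, derivable y x 1) -> c <= d ->
  (forall x, c < x < d -> derive1 y x = s) -> y d - y c = s * (d - c).
Proof.
move=> dy; rewrite le_eqVlt => /predU1P[->|cd] dys; first by rewrite !subrr mulr0.
have dyx x : x \in `]c, d[ -> is_derive x 1 y (derive1 y x).
  by move=> _; apply: DeriveDef; [exact: dy | rewrite derive1E].
have cy : {within `[c, d], continuous y}.
  apply: continuous_subspaceT => x.
  by apply: differentiable_continuous; exact/derivable1_diffP.
by have [x xcd ->] := MVT cd dyx cy; rewrite dys// -in_itv.
Qed.

(** By the mean value theorem [y] grows linearly, so its absolute value is at least 1 on a
    half-line. *)
Lemma not_in_L1_derive_cst_right y c s : (forall x, derivable y x 1) ->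
  (forall x, c < x -> derive1 y x = s) -> s != 0 -> ~ in_L1 y.
Proof.
move=> dy dys s0; have s_gt0 : 0 < `|s| by rewrite normr_gt0.
(* Chosen so that a change of [y] by at least [|s| * r] from [y c] leaves an absolute value of at
   least 1. *)
pose r := (1 + `|y c|) / `|s|.
have r0 : 0 <= r by rewrite divr_ge0// addr_ge0.
apply: (@not_in_L1 _ _ [set` `[c + r, +oo[]).
- exact: measurable_itv.
- by rewrite lebesgue_measure_itv/= ltry.
move=> x /=; rewrite in_itv/= andbT => crx.
have cx : c <= x by rewrite (le_trans _ crx)// lerDl.
have := derive_cst_increment dy cx (fun t H => dys t (proj1 (andP H))).
move=> /(congr1 Num.norm); rewrite normrM [`|x - c|]ger0_norm ?subr_ge0// => E.
have : 1 + `|y c| <= `|s| * (x - c) by rewrite mulrC -ler_pdivrMr// lerBrDl.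
by rewrite -E; have := ler_normB (y x) (y c); lra.
Qed.

Lemma not_in_L1_derive_cst_left y c s : (forall x, derivable y x 1) ->
  (forall x, x < c -> derive1 y x = s) -> s != 0 -> ~ in_L1 y.
Proof.
move=> dy dys s0; have s_gt0 : 0 < `|s| by rewrite normr_gt0.
pose r := (1 + `|y c|) / `|s|.
have r0 : 0 <= r by rewrite divr_ge0// addr_ge0.
apply: (@not_in_L1 _ _ [set` `]-oo, c - r]]).
- exact: measurable_itv.
- by rewrite lebesgue_measure_itv/= ltNyr.
move=> x /=; rewrite in_itv/= => xcr.
have xc : x <= c by rewrite (le_trans xcr)// gerBl.
have := derive_cst_increment dy xc (fun t H => dys t (proj2 (andP H))).
move=> /(congr1 Num.norm); rewrite normrM [`|c - x|]ger0_norm ?subr_ge0// => E.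
have : 1 + `|y c| <= `|s| * (c - x).
  by rewrite mulrC -ler_pdivrMr// lerBrDl addrC -lerBrDl.
by rewrite -E; have := ler_normB (y c) (y x); lra.
Qed.

(* If [q] vanished, a solution for [f] the indicator of [[0, 1]] would satisfy
   [y' + ramp = k], hence be affine with slopes [k] and [k - 1] on the two
   half-lines, and these slopes cannot both be zero. *)
Lemma correctly_solvable_neq0 q : correctly_solvable q ->
  ~ {ae mu, forall x, q x = 0}.
Proof.
move=> [solv _] q0.
(* The two booleans select the closed interval [[0, 1]]. *)
have [y [[[ACy yE] yL1] _]] := solv _ (integrable_indic_itv 0 1 true false).
have [dy _ acy'] := ACy.
(* The factor 1 gives the sum the shape of the combination lemmas. *)
have cst : forall x x', 1 * derive1 y x + ramp x = 1 * derive1 y x' + ramp x'.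
  apply: (@ACloc_ae_derive_eq0 _ (fun x => 1 * derive1 y x + ramp x)).
    move=> c d cd; apply: abs_continuous_on_combination;
      [exact: acy'|exact: ACloc_ramp].
  have D2y : {ae mu, forall x, D2 y x = - \1_`[0, 1] x}.
    by apply: filterS2 q0 yE => x -> <-; ring.
  have := ACloc_ae_derivable acy'.
  apply: filterS3 D2y ae_derive1_ramp => x yEx [dr rE] dy'.
  have [_ ->] := derive1_combination 1 dy' dr.
  by rewrite rE -[derive1 _ x]/(D2 y x) yEx; ring.
have right x : 1 < x -> derive1 y x = derive1 y 0 - 1.
  move=> x1; have := cst x 0; rewrite /ramp min_r ?max_r ?min_l ?max_l//; lra.
have left x : x < 0 -> derive1 y x = derive1 y 0.
  move=> x0; have := cst x 0; rewrite /ramp !min_l ?max_l//; lra.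
have [k0|k0] := eqVneq (derive1 y 0) 0.
  apply: (not_in_L1_derive_cst_right dy right) yL1.
  by rewrite k0 sub0r oppr_eq0 oner_eq0.
exact: (not_in_L1_derive_cst_left dy left).
Qed.

End nonzero_potential.

(* [T u] is [D2 u - q u] for [S12] and [D2 u] for [W12]. *)
Section weighted_normed_space.
Context {R : realType}.
Variables (q : R -> R) (T : (R -> R) -> R -> R).
Implicit Types (u v : R -> R) (a : R).
Local Notation mu := (@lebesgue_measure R).

Hypothesis mq : measurable_fun [set: R] q.
Hypothesis mT : forall u, ACloc1 u -> measurable_fun [set: R] (T u).
Hypothesis linT : forall u v a, ACloc1 u -> ACloc1 v ->
  {ae mu, forall x, T (fun x => a * u x + v x) x = a * T u x + T v x}.
Hypothesis defT : forall u, ACloc1 u -> {ae mu, forall x, T u x = 0} ->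
  {ae mu, forall x, q x * u x = 0} -> u = (fun=> 0).

(** For the two choices of [T] this unfolds to [S12_enorm q] and [W12_enorm q]. *)
Definition weighted_enorm u : \bar R :=
  (L1norm (T u) + L1norm (fun x => (q x * u x)%R))%E.

Let mqu u : ACloc1 u -> measurable_fun [set: R] (fun x => q x * u x).
Proof.
move=> ACu; apply: measurable_funM => //.
by apply: continuous_measurable_fun; exact: ACloc1_continuous.
Qed.

Lemma weighted_enorm_ge0 u : (0 <= weighted_enorm u)%E.
Proof. by rewrite adde_ge0 ?L1norm_ge0. Qed.

(** Closure, homogeneity and the triangle inequality are all drawn from this bound. Linearity of [T]
    almost everywhere suffices, as [L1norm] does not see null sets. *)
Lemma weighted_enorm_combination u v a : ACloc1 u -> ACloc1 v ->
  (weighted_enorm (fun x => (a * u x + v x)%R) <=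
    `|a|%:E * weighted_enorm u + weighted_enorm v)%E.
Proof.
move=> ACu ACv; have ACuv := ACloc1_combination a ACu ACv.
rewrite /weighted_enorm ge0_muleDr ?L1norm_ge0//.
rewrite addeACA leeD//.
  rewrite (L1norm_ae_eq _ _ (linT a ACu ACv)); last 2 first.
  - exact: mT.
  - by apply: measurable_funD; [apply: measurable_funM => //|]; exact: mT.
  by apply: L1norm_combination; exact: mT.
rewrite (_ : (fun x => _) = (fun x => a * (q x * u x) + q x * v x)).
  by apply: L1norm_combination; exact: mqu.
by apply/funext => x; ring.
Qed.

Lemma weighted_enorm_cst0 : weighted_enorm (fun=> 0) = 0%E.
Proof.
have AC0 := @ACloc1_cst0 R.
have T0 : {ae mu, forall x, T (fun=> 0) x = 0}.
  (* Writing 0 as [-1 * 0 + 0] makes [T] of it equal to its own negative plus itself, almost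
     everywhere. *)
  have := linT (-1) AC0 AC0.
  rewrite (_ : (fun x => _) = (fun=> 0)); last by apply/funext => x; ring.
  by apply: filterS => x ->; ring.
rewrite /weighted_enorm (L1norm_ae_eq (mT AC0) _ T0)//.
rewrite (_ : (fun x => q x * 0) = (fun=> 0)).
  rewrite !L1normE; under eq_integral do rewrite normr0.
  by rewrite integral0 adde0.
by apply/funext => x; rewrite mulr0.
Qed.

Lemma weighted_normed_space :
  normed_space [set u | ACloc1 u /\ (weighted_enorm u < +oo)%E]
               (fun u => fine (weighted_enorm u)).
Proof.
have fin u : (weighted_enorm u < +oo)%E -> weighted_enorm u \is a fin_num.
  by move=> uoo; rewrite ge0_fin_numE// weighted_enorm_ge0.
have comb a u v : ACloc1 u /\ (weighted_enorm u < +oo)%E ->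
    ACloc1 v /\ (weighted_enorm v < +oo)%E ->
    [/\ ACloc1 (fun x => a * u x + v x),
        (weighted_enorm (fun x => a * u x + v x)%R < +oo)%E &
        fine (weighted_enorm (fun x => a * u x + v x)) <=
          `|a| * fine (weighted_enorm u) + fine (weighted_enorm v)].
  move=> [ACu /fin uoo] [ACv /fin voo].
  have le := weighted_enorm_combination a ACu ACv.
  have lt : (weighted_enorm (fun x => a * u x + v x)%R < +oo)%E.
    by rewrite (le_lt_trans le)// -(fineK uoo) -(fineK voo) -EFinM -EFinD ltry.
  split => //; first exact: ACloc1_combination.
  by rewrite -lee_fin (fineK (fin _ lt)) EFinD EFinM (fineK uoo) (fineK voo).
have B0 : ACloc1 (fun=> 0 : R) /\ (weighted_enorm (fun=> 0%R) < +oo)%E.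
  by split; [exact: ACloc1_cst0 | rewrite weighted_enorm_cst0 ltry].
have scale a u : ACloc1 u /\ (weighted_enorm u < +oo)%E ->
    (ACloc1 (fun x => a * u x) /\ (weighted_enorm (fun x => a * u x)%R < +oo)%E) /\
    fine (weighted_enorm (fun x => a * u x)) <= `|a| * fine (weighted_enorm u).
  move=> Bu; have [] := comb a u _ Bu B0.
  rewrite weighted_enorm_cst0 /= addr0.
  by rewrite (_ : (fun x => _ + 0) = (fun x => a * u x))//; apply/funext => x; ring.
split.
- by split=> // a u v Bu Bv; have [] := comb a u v Bu Bv.
- by move=> u _; rewrite fine_ge0// weighted_enorm_ge0.
- move=> u [ACu /fin uoo] u0.
  have /eqP : weighted_enorm u = 0%E by rewrite -(fineK uoo) u0.
  rewrite /weighted_enorm padde_eq0 ?L1norm_ge0// => /andP[/eqP Tu /eqP qu].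
  by apply: defT => //; apply: L1norm_eq0 => //; [exact: mT | exact: mqu].
- move=> a u Bu; have [Bau leau] := scale a u Bu.
  apply/eqP; rewrite eq_le leau/=.
  have [->|a0] := eqVneq a 0.
    by rewrite normr0 mul0r fine_ge0// weighted_enorm_ge0.
  (* The reverse inequality is [scale] applied to the factor [a^-1] and the function [a * u]. *)
  have [_] := scale a^-1 _ Bau.
  rewrite (_ : (fun x => a^-1 * _) = u); last first.
    by apply/funext => x; rewrite mulKf.
  by rewrite normfV mulrC ler_pdivlMr ?normr_gt0// mulrC.
- move=> u v Bu Bv; have [_ _] := comb 1 u v Bu Bv.
  rewrite normr1 mul1r (_ : (fun x => 1 * _ + _) = (fun x => u x + v x))//.
  by apply/funext => x; rewrite mul1r.
Qed.

End weighted_normed_space.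

(** * Comparison of the two spaces *)

Section isomorphism.
Context {R : realType}.
Variable q : R -> R.
Implicit Types u v : R -> R.
Local Notation mu := (@lebesgue_measure R).

Hypothesis mq : measurable_fun [set: R] q.

Let mqu u : ACloc1 u -> measurable_fun [set: R] (fun x => q x * u x).
Proof.
move=> ACu; apply: measurable_funM => //.
by apply: continuous_measurable_fun; exact: ACloc1_continuous.
Qed.

Let mS u : ACloc1 u -> measurable_fun [set: R] (fun x => D2 u x - q x * u x).
Proof. by move=> ACu; apply: measurable_funB; [exact: measurable_D2 | exact: mqu]. Qed.

(** [u] is affine; were it not zero, it would have at most one zero, and [q] would vanish almost
    everywhere. *)
Lemma ACloc1_eq0 u : ~ {ae mu, forall x, q x = 0} -> ACloc1 u ->
  {ae mu, forall x, D2 u x = 0} -> {ae mu, forall x, q x * u x = 0} ->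
  u = (fun=> 0).
Proof.
move=> q0 ACu D2u0 qu0; have [k uE] := ACloc1_affine ACu D2u0.
apply: contrapT => u0; apply: q0.
(* The only possible zero of a nonconstant [u]. For [k = 0] the quotient is 0 by convention, and the
   constant case is settled separately. *)
have : {ae mu, forall x, x != - u 0 / k}.
  exists [set - u 0 / k]; split.
  - exact: measurable_set1.
  - exact: lebesgue_measure_set1.
  - by move=> x /= /negP; rewrite negbK => /eqP.
apply: filterS2 qu0 => x /eqP; rewrite mulf_eq0 => /orP[/eqP//|/eqP ux0] xk.
exfalso; move: ux0; rewrite uE.
have [k0|k0] := eqVneq k 0.
  rewrite k0 mul0r addr0 => u00; apply: u0; apply/funext => t.
  by rewrite uE u00 k0 mul0r addr0.
move=> /eqP; rewrite addrC addr_eq0 => /eqP kx; move/eqP: xk; apply.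
by rewrite -kx mulrC mulKf.
Qed.

(** Since [D2 u] is the sum of [q u] and [D2 u - q u], the norm of [q u] is counted twice, whence
    the factor 2. *)
Lemma W12_le_S12 u : ACloc1 u -> (W12_enorm q u <= 2%:E * S12_enorm q u)%E.
Proof.
move=> ACu; rewrite /W12_enorm /S12_enorm.
have := L1norm_combination 1 (mqu ACu) (mS ACu).
rewrite (_ : (fun x => 1 * _ + _) = D2 u); last by apply/funext => x; ring.
rewrite normr1 mul1e addeC => le.
rewrite (le_trans (leeD le (lexx _)))// mule_natl mule2n.
by rewrite leeD2l// leeDr// L1norm_ge0.
Qed.

Lemma S12_le_W12 u : ACloc1 u -> (S12_enorm q u <= 2%:E * W12_enorm q u)%E.
Proof.
move=> ACu; rewrite /W12_enorm /S12_enorm.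
have := L1norm_combination (-1) (mqu ACu) (measurable_D2 ACu).
rewrite (_ : (fun x => -1 * _ + _) = (fun x => D2 u x - q x * u x)); last first.
  by apply/funext => x; ring.
rewrite normrN1 mul1e addeC => le.
rewrite (le_trans (leeD le (lexx _)))// mule_natl mule2n.
by rewrite leeD2l// leeDr// L1norm_ge0.
Qed.

Lemma S12_eq_W12 : S12 q = W12 q.
Proof.
by apply/seteqP; split => u [ACu uoo]; split => //;
  [apply: le_lt_trans (W12_le_S12 ACu) _ | apply: le_lt_trans (S12_le_W12 ACu) _];
  rewrite lte_mul_pinfty.
Qed.

Lemma normed_space_S12 : ~ {ae mu, forall x, q x = 0} ->
  normed_space (S12 q) (S12_norm q).
Proof.
move=> q0; apply: (weighted_normed_space (T := fun u x => D2 u x - q x * u x)) => //.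
- move=> u v a ACu ACv; have := ae_D2_combination a ACu ACv.
  by apply: filterS => x ->; ring.
- move=> u ACu uE quE; apply: ACloc1_eq0 => //.
  by apply: filterS2 uE quE => x + qux; rewrite qux subr0.
Qed.

Lemma normed_space_W12 : ~ {ae mu, forall x, q x = 0} ->
  normed_space (W12 q) (W12_norm q).
Proof.
move=> q0; apply: (weighted_normed_space (T := @D2 R)) => //.
- exact: measurable_D2.
- by move=> u v a ACu ACv; exact: ae_D2_combination.
- by move=> u; exact: ACloc1_eq0.
Qed.

Lemma equivalent_norms_S12_W12 :
  equivalent_norms (S12 q) (S12_norm q) (W12_norm q).
Proof.
(* The lower constant comes from [S12_le_W12], the upper one from [W12_le_S12]. *)
exists (1 / 2), 2; split => // u Su.
have [ACu Soo] := Su; have [_ Woo] : W12 q u by rewrite -S12_eq_W12.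
have Sfin : S12_enorm q u \is a fin_num.
  by rewrite ge0_fin_numE// adde_ge0// L1norm_ge0.
have Wfin : W12_enorm q u \is a fin_num.
  by rewrite ge0_fin_numE// adde_ge0// L1norm_ge0.
have := W12_le_S12 ACu; have := S12_le_W12 ACu.
rewrite -(fineK Sfin) -(fineK Wfin) -!EFinM !lee_fin -/(S12_norm q u) -/(W12_norm q u).
by move=> h1 h2; split => //; lra.
Qed.

End isomorphism.

Theorem theorem1p4 (R : realType) (q : R -> R)
    (q_loc : locally_integrable [set: R] q)
    (q_ge0 : {ae @lebesgue_measure R, forall x, 0 <= q x})
    (q_solv : correctly_solvable q) :
  isomorphic (S12 q) (S12_norm q) (W12 q) (W12_norm q).
Proof.
(* With [q = 0] almost everywhere, nonzero constants would have norm 0; solvability rules this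
   out. *)
have [mq _ _] := q_loc; have q0 := correctly_solvable_neq0 q_solv.
split.
- exact: normed_space_S12.
- exact: normed_space_W12.
- exact: S12_eq_W12.
- exact: equivalent_norms_S12_W12.
Qed.
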